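(* There are no solvable subalgebras in $\mathfrak{so}(4,\mathbb{C})$ of dimension greater than $4$.
   Context: $\mathfrak{so}(4,\mathbb{C})\cong\mathfrak{sl}(2,\mathbb{C})\oplus\mathfrak{sl}(2,\mathbb{C})$ is realized as the Lie algebra of $4\times4$ complex block diagonal matrices with two traceless $2\times 2$ diagonal blocks. Subalgebras are complex Lie subalgebras and dimension is over $\mathbb{C}$. *)

(* Defs.v *)
From mathcomp Require Import all_boot all_order all_algebra.
From mathcomp Require Import reals.
From mathcomp Require Import complex.

Set Implicit Arguments.
Unset Strict Implicit.
Unset Printing Implicit Defensive.

Import GRing.Theory.
Local Open Scope ring_scope.

Section LieMatrix.
Variables (F : fieldType) (n : nat).
Implicit Types (A B : 'M[F]_n) (U V W L : {vspace 'M[F]_n}).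

Definition mxlie A B : 'M[F]_n := A *m B - B *m A.

Definition lie_subalgebra L : Prop :=
  forall A B, A \in L -> B \in L -> mxlie A B \in L.

(* [U, V], the span of all brackets of an element of U with one of V; by
   bilinearity bases suffice, and [lie_prodvP] is the universal property. *)
Definition lie_prodv U V : {vspace 'M[F]_n} :=
  <<[seq mxlie A B | A <- vbasis U, B <- vbasis V]>>%VS.

Definition derived_series (k : nat) L : {vspace 'M[F]_n} :=
  iter k (fun U => lie_prodv U U) L.

Definition lie_solvable L : Prop := exists k, derived_series k L = 0%VS.

Lemma lie_prodvP U V W :
  (forall A B, A \in U -> B \in V -> mxlie A B \in W)
    <-> (lie_prodv U V <= W)%VS.
Proof.
split=> [UVW | /span_subvP UVW A B UA VB].
  by apply/span_subvP=> _ /allpairsP[[A B] /= [UA VB ->]];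
    apply: UVW; apply: vbasis_mem.
rewrite (coord_vbasis UA) (coord_vbasis VB) /mxlie mulmx_suml mulmx_sumr -sumrB.
apply: memv_suml => i _.
rewrite mulmx_sumr mulmx_suml -sumrB; apply: memv_suml => j _.
rewrite -!scalemxAl -!scalemxAr !scalerA mulrC -scalerBr.
by apply/memvZ/UVW/allpairs_f; apply: mem_nth; rewrite size_tuple.
Qed.

End LieMatrix.

Definition so4 (R : realType) (A : 'M[R[i]]_(2 + 2)) : Prop :=
  exists X Y : 'M[R[i]]_2, [/\ \tr X = 0, \tr Y = 0 & A = block_mx X 0 0 Y].

(* Main.v *)
(** Since sl(2) is perfect, it is its only subspace of dimension at least 3 and
    it is not solvable; so each of the two block projections of a solvable
    subalgebra L of so(4) = sl(2) + sl(2) has dimension at most 2.  The kernel of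
    the first projection on L embeds through the second one, whence
    dim L <= 2 + 2. *)
Require Import Defs.
From mathcomp Require Import all_boot all_order all_algebra.
From mathcomp Require Import reals complex.
Import GRing.Theory Num.Theory.
Local Open Scope ring_scope.

Lemma mem_lie_prodv {F : fieldType} {n : nat} (U V : {vspace 'M[F]_n}) A B :
  A \in U -> B \in V -> mxlie A B \in lie_prodv U V.
Proof. by move: A B; apply/lie_prodvP/subvv. Qed.

Lemma lie_prodvS {F : fieldType} {n : nat} (U V U' V' : {vspace 'M[F]_n}) :
  (U <= U')%VS -> (V <= V')%VS -> (lie_prodv U V <= lie_prodv U' V')%VS.
Proof.
move=> /subvP sU /subvP sV; apply/lie_prodvP => A B UA VB.
by apply: mem_lie_prodv; [exact: sU | exact: sV].
Qed.

Lemma derived_series_sub {F : fieldType} {n : nat} (L : {vspace 'M[F]_n}) k :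
  lie_subalgebra L -> (derived_series k L <= L)%VS.
Proof.
move=> algL; elim: k => [|k IHk] /=; first exact: subvv.
exact: subv_trans (lie_prodvS _ _ _ _ IHk IHk) (iffLR (lie_prodvP _ _ _) algL).
Qed.

(** Compatibility with brackets is asked on [L] only, because extracting a block respects products
    of block diagonal matrices but not of arbitrary ones. Closure of [L] keeps its derived series
    inside [L], where this compatibility applies. *)
Lemma lie_solvable_limg {F : fieldType} {m n : nat} (L : {vspace 'M[F]_m})
    (p : 'Hom('M[F]_m, 'M[F]_n)) :
    {in L &, {morph p : A B / mxlie A B}} ->
  lie_subalgebra L -> lie_solvable L -> lie_solvable (p @: L)%VS.
Proof.
(* Writing 0 as the image of the [k]-th derived term of [L] leaves an inclusion that holds for every
   [k], by induction. *)
move=> pM algL [k solL]; exists k; apply/eqP; rewrite -subv0 -(limg0 p) -solL.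
elim: k {solL} => [|k IHk] /=; first exact: subvv.
apply: subv_trans (lie_prodvS _ _ _ _ IHk IHk) _.
have /subvP DkL := derived_series_sub L k algL.
apply/lie_prodvP => _ _ /memv_imgP[A DA ->] /memv_imgP[B DB ->].
rewrite -pM; [|exact: DkL..].
exact/memv_img/mem_lie_prodv.
Qed.

Section Sl2.
Variable F : fieldType.

Definition sl2_e : 'M[F]_2 := delta_mx 0 1.
Definition sl2_f : 'M[F]_2 := delta_mx 1 0.
Definition sl2_h : 'M[F]_2 := delta_mx 0 0 - delta_mx 1 1.
Definition sl2v : {vspace 'M[F]_2} := <<[:: sl2_e; sl2_f; sl2_h]>>%VS.

Lemma mem_sl2v (X : 'M[F]_2) : \tr X = 0 -> X \in sl2v.
Proof.
rewrite /mxtrace !big_ord_recl big_ord0 addr0.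
have -> : lift ord0 ord0 = 1 :> 'I_2 by apply/val_inj.
move=> /eqP; rewrite addrC addr_eq0 => /eqP X11.
(* The lower right entry agrees because trace zero makes it [- X 0 0]. *)
have -> : X = X 0 1 *: sl2_e + X 1 0 *: sl2_f + X 0 0 *: sl2_h.
  have ordP (i : 'I_2) : i = 0 \/ i = 1.
    by case: i => [[|[|//]] ?]; [left | right]; apply/val_inj.
  apply/matrixP=> i j; rewrite !mxE; case: (ordP i) => ->; case: (ordP j) => -> /=;
    by rewrite ?X11 !(mulr1, mulr0, subr0, sub0r, mulrN, addr0, add0r).
by rewrite !memvD // memvZ // memv_span // !inE eqxx ?orbT.
Qed.

Lemma dim_sl2v : (\dim sl2v <= 3)%N.
Proof. exact: dim_span. Qed.

Hypothesis char2 : (2%:R : F) != 0.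

(** The relations [h,e] = 2e, [f,h] = 2f and [e,f] = h exhibit each generator as a multiple of a
    bracket once 2 is invertible. *)
Lemma sl2v_perfect : (sl2v <= lie_prodv sl2v sl2v)%VS.
Proof.
have [se sf sh] : [/\ sl2_e \in sl2v, sl2_f \in sl2v & sl2_h \in sl2v].
  by split; rewrite memv_span // !inE eqxx ?orbT.
apply/span_subvP=> X; rewrite !inE => /or3P[] /eqP->.
- have -> : sl2_e = 2%:R^-1 *: mxlie sl2_h sl2_e.
    rewrite /mxlie mulmxBl mulmxBr !mul_delta_mx_cond /= !mulr0n !mulr1n.
    by rewrite subr0 sub0r opprK -mulr2n -scaler_nat scalerA mulVf // scale1r.
  exact/memvZ/mem_lie_prodv.
- have -> : sl2_f = 2%:R^-1 *: mxlie sl2_f sl2_h.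
    rewrite /mxlie mulmxBl mulmxBr !mul_delta_mx_cond /= !mulr0n !mulr1n.
    by rewrite subr0 sub0r opprK -mulr2n -scaler_nat scalerA mulVf // scale1r.
  exact/memvZ/mem_lie_prodv.
have -> : sl2_h = mxlie sl2_e sl2_f by rewrite /mxlie !mul_delta_mx.
exact: mem_lie_prodv.
Qed.

(** By perfectness every derived term still contains [sl2v], hence the nonzero matrix [sl2_e]. *)
Lemma sl2v_not_solvable : ~ lie_solvable sl2v.
Proof.
case=> k solk; have : (sl2v <= 0)%VS.
  rewrite -solk; elim: k {solk} => [|k IHk] /=; first exact: subvv.
  exact: subv_trans sl2v_perfect (lie_prodvS _ _ _ _ IHk IHk).
move/subvP/(_ sl2_e); rewrite memv_span ?mem_head // memv0 => /(_ isT)/eqP.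
by move/matrixP/(_ 0 1)/eqP; rewrite !mxE /= oner_eq0.
Qed.

Lemma dim_solvable_sl2 (V : {vspace 'M[F]_2}) :
  (V <= sl2v)%VS -> lie_solvable V -> (\dim V <= 2)%N.
Proof.
move=> sV solV; rewrite leqNgt; apply/negP => dimV.
suff VE : V = sl2v by apply: sl2v_not_solvable; rewrite -VE.
by apply/eqP; rewrite eqEdim sV (leq_trans dim_sl2v).
Qed.

End Sl2.

Theorem theorem5p10 (R : realType) :
  ~ exists L : {vspace 'M[R[i]]_(2 + 2)},
      [/\ forall A, A \in L -> so4 A,
          lie_subalgebra L,
          lie_solvable L
        & (4 < \dim L)%N].
Proof.
case=> L [so4L algL solL]; apply/negP; rewrite -leqNgt.
(* [p1] and [p2] extract the upper left and the lower right block. *)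
pose p1 : 'Hom('M[R[i]]_(2 + 2), 'M[R[i]]_2) := linfun (lsubmx \o usubmx).
pose p2 : 'Hom('M[R[i]]_(2 + 2), 'M[R[i]]_2) := linfun (rsubmx \o dsubmx).
have p1E (X Y : 'M[R[i]]_2) : p1 (block_mx X 0 0 Y) = X.
  by rewrite lfunE /= block_mxEv col_mxKu row_mxKl.
have p2E (X Y : 'M[R[i]]_2) : p2 (block_mx X 0 0 Y) = Y.
  by rewrite lfunE /= block_mxEv col_mxKd row_mxKr.
have char2 : (2%:R : R[i]) != 0 by rewrite pnatr_eq0.
have mxlie_block (X Y X' Y' : 'M[R[i]]_2) :
    mxlie (block_mx X 0 0 Y) (block_mx X' 0 0 Y')
    = block_mx (mxlie X X') 0 0 (mxlie Y Y').
  by rewrite /mxlie !mulmx_block opp_block_mx add_block_mx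
             !(mulmx0, mul0mx, addr0, add0r, oppr0).
have p1M : {in L &, {morph p1 : A B / mxlie A B}}.
  move=> A B /so4L[X [Y [_ _ ->]]] /so4L[X' [Y' [_ _ ->]]].
  by rewrite mxlie_block !p1E.
have p2M : {in L &, {morph p2 : A B / mxlie A B}}.
  move=> A B /so4L[X [Y [_ _ ->]]] /so4L[X' [Y' [_ _ ->]]].
  by rewrite mxlie_block !p2E.
have dim1 : (\dim (p1 @: L) <= 2)%N.
  apply: (dim_solvable_sl2 _ char2); last exact: lie_solvable_limg.
  apply/subvP=> _ /memv_imgP[A /so4L[X [Y [trX _ ->]]] ->].
  by rewrite p1E mem_sl2v.
have dim2 : (\dim (p2 @: L) <= 2)%N.
  apply: (dim_solvable_sl2 _ char2); last exact: lie_solvable_limg.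
  apply/subvP=> _ /memv_imgP[A /so4L[X [Y [_ trY ->]]] ->].
  by rewrite p2E mem_sl2v.
(* Elements of [L] are determined by their two diagonal blocks, so [p2] is injective on the kernel
   of [p1] in [L]. *)
have ker12 : (L :&: lker p1 :&: lker p2 = 0)%VS.
  apply/eqP; rewrite -subv0; apply/subvP=> A.
  rewrite !memv_cap !memv_ker => /andP[/andP[/so4L[X [Y [_ _ ->]]]]].
  rewrite p1E p2E => /eqP-> /eqP->.
  by rewrite memv0 block_mx0.
(* Rank-nullity for [p1] on [L], with the kernel replaced by its image under [p2], which lies in
   [p2 @: L]. *)
rewrite -(limg_ker_dim p1 L) -(limg_dim_eq ker12) -[4%N]/(2 + 2)%N leq_add //.
by apply: leq_trans dim2; rewrite dimvS // limgS // capvSl.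
Qed.
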